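(* Let $1<p<\infty$, let $V:\mathbb{R}^n\to[0,\infty)$ be a $p$-homogeneous convex function, and let $\nu$ be a Borel measure on $\mathbb{R}^n$ whose density with respect to Lebesgue measure is proportional to $e^{-V}$ (i.e. $\frac{d\nu}{dx}=c\,e^{-V}$ for some constant $c>0$). Let $K_0,K_1\subseteq\mathbb{R}^n$ be non-empty star bodies. Then for all $0\le t\le 1$, $$\nu\big((1-t)K_0+tK_1\big)^{\frac{p-1}{pn}}\ \ge\ (1-t)\,\nu(K_0)^{\frac{p-1}{pn}}+t\,\nu(K_1)^{\frac{p-1}{pn}}.$$
   Context: A function $V$ is $p$-homogeneous if $V(\lambda x)=\lambda^pV(x)$ for all $x\in\mathbb{R}^n$, $\lambda>0$. A star body is a Borel set $K\subseteq\mathbb{R}^n$ such that $\lambda x\in K$ for all $x\in K$ and $0\le\lambda\le1$ (no convexity, symmetry or compactness is assumed). The Minkowski average is $(1-t)K_0+tK_1=\{(1-t)x+ty: x\in K_0,\ y\in K_1\}$ (it is Lebesgue measurable, so its $\nu$-measure makes sense). Measures of sets may take the value $+\infty$, with the convention $0\cdot\infty=0$. *)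

(* Defs.v *)
From HB Require Import structures.
From mathcomp Require Import all_boot all_order all_algebra.
From mathcomp Require Import all_classical all_reals all_analysis.
From mathcomp Require Import measurable_realfun.

Set Implicit Arguments.
Unset Strict Implicit.
Unset Printing Implicit Defensive.
Import Order.TTheory GRing.Theory Num.Theory.
Import numFieldNormedType.Exports.

Local Open Scope classical_set_scope.
Local Open Scope ring_scope.

(* R^n as row vectors, with the sigma-algebra generated by the open sets. *)
Notation borelRV R n := (g_sigma_algebraType (@open 'rV[R]_n)).

Section borel_row_vectors.
Context {R : realType}.

Lemma measurable_coord n (j : 'I_n) :
  measurable_fun [set: borelRV R n]
    (fun v : borelRV R n => (v : 'rV[R]_n) ord0 j : R).
Proof.
apply: (measurability _ (RGenOpens.measurableE R)) => _ [_ [a [b ->]] <-].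
rewrite setTI; apply: sub_sigma_algebra.
apply: (@open_comp _ _ (fun v : 'rV[R]_n => v ord0 j)) => [v _|].
  exact: coord_continuous.
exact: interval_open.
Qed.

Lemma measurable_fun_coordP d (S : measurableType d) n (f : S -> borelRV R n) :
  (forall j, measurable_fun setT (fun x => (f x : 'rV[R]_n) ord0 j : R)) ->
  measurable_fun setT f.
Proof.
move=> mf; apply: (@measurability _ _ S (borelRV R n) setT f (@open 'rV[R]_n)) => [//|].
move=> _ [U oU <-]; rewrite setTI.
pose box (q : {ffun 'I_n -> rat * rat}) := [set v : 'rV[R]_n |
  forall j, ratr (q j).1 < v ord0 j < ratr (q j).2].
pose F q := if `[< box q `<=` U >] then f @^-1` box q else set0.
have -> : f @^-1` U = \bigcup_q F q.
  apply/seteqP; split => [x Ux|x [q _]]; rewrite /F; last first.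
    by case: asboolP => // qU /qU.
  have : nbhs (f x : 'rV[R]_n) U by rewrite nbhsE /=; exists U.
  move=> /nbhs_ballP[e /= e0 eU].
  have h (j : 'I_n) : exists r : rat * rat,
      ((f x : 'rV[R]_n) ord0 j - e < ratr r.1 < (f x : 'rV[R]_n) ord0 j) /\
      ((f x : 'rV[R]_n) ord0 j < ratr r.2 < (f x : 'rV[R]_n) ord0 j + e).
    have /rat_in_itvoo[r1] : (f x : 'rV[R]_n) ord0 j - e
      < (f x : 'rV[R]_n) ord0 j by rewrite ltrBlDr ltrDl.
    have /rat_in_itvoo[r2] : (f x : 'rV[R]_n) ord0 j <
       (f x : 'rV[R]_n) ord0 j + e by rewrite ltrDl.
    by rewrite !in_itv /= => *; exists (r1, r2).
  pose q : {ffun 'I_n -> rat * rat} := [ffun j => projT1 (cid (h j))].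
  exists q => //; case: asboolP => [_ j|[]].
    rewrite /q ffunE; case: cid => r /= [/andP[_ r1] /andP[r2 _]].
    by rewrite r1.
  move=> v vq; apply: eU; split=> // i j; rewrite (ord1 i).
  move: (vq j); rewrite /q ffunE; case: cid => r /=.
  move=> [/andP[r1 _] /andP[_ r2]] /andP[v1 v2].
  by rewrite -ball_normE /= ltr_distlC (lt_trans r1 v1) (lt_trans v2 r2).
apply: countable_bigcupT_measurable => // q.
rewrite /F; case: asboolP => // _.
have -> : f @^-1` box q = \bigcap_(j in [set: 'I_n])
    ((fun x => (f x : 'rV[R]_n) ord0 j : R) @^-1`
      `](ratr (q j).1), (ratr (q j).2)[%classic).
  by apply/seteqP; split => x /= h j; [move=> _|];
    have := h j; rewrite /= in_itv /=; [|exact].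
apply: fin_bigcap_measurable => [|j _]; first exact: finite_finset.
by rewrite -[X in measurable X]setTI; exact: mf.
Qed.

Definition rv_cons n (p : R * borelRV R n) : borelRV R n.+1 :=
  \row_(i < n.+1) oapp ((p.2 : 'rV[R]_n) ord0) p.1 (unlift ord0 i).

Lemma measurable_rv_cons n : measurable_fun setT (@rv_cons n).
Proof.
apply: measurable_fun_coordP => j; rewrite /rv_cons.
case: (unliftP ord0 j) => [k ->|->].
  under eq_fun do rewrite mxE liftK /=.
  exact: measurableT_comp (measurable_coord k) measurable_snd.
under eq_fun do rewrite mxE unlift_none /=.
exact: measurable_fst.
Qed.

Definition lebesgue_cons n
    (mu : {sigma_finite_measure set (borelRV R n) -> \bar R}) :=
  pushforward (@lebesgue_measure R \x mu)%E (@rv_cons n).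

Section lebesgue_cons_measure.
Context n (mu : {sigma_finite_measure set (borelRV R n) -> \bar R}).

HB.instance Definition _ := Measure.copy (lebesgue_cons mu)
  (measure_function_pushforward__canonical__measure_function_Measure
     (@lebesgue_measure R \x mu)%E (@measurable_rv_cons n)).

Let lebesgue_cons_sigma_finite : sigma_finite setT (lebesgue_cons mu).
Proof.
have /sigma_finiteP[F [TF ndF Foo]] := sigma_finiteT (@lebesgue_measure R).
have /sigma_finiteP[G [TG ndG Goo]] := sigma_finiteT mu.
pose g (v : borelRV R n.+1) : R * borelRV R n :=
  ((v : 'rV[R]_n.+1) ord0 ord0, \row_j (v : 'rV[R]_n.+1) ord0 (lift ord0 j)).
have mg : measurable_fun setT g.
  apply/measurable_fun_pairP; split; first exact: measurable_coord.
  apply: measurable_fun_coordP => j.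
  under eq_fun do rewrite mxE.
  exact: measurable_coord.
have gK : cancel (@rv_cons n) g.
  move=> [x v]; rewrite /g /rv_cons /= mxE unlift_none /=; congr pair.
  by apply/rowP => j; rewrite !mxE liftK.
exists (fun k => g @^-1` (F k `*` G k)) => [|k].
  apply/seteqP; split => // v _.
  have [i _ Fi] : (\bigcup_i F i) (g v).1 by rewrite -TF.
  have [j _ Gj] : (\bigcup_i G i) (g v).2 by rewrite -TG.
  exists (maxn i j) => //; split.
  - by move: Fi; exact/subsetPset/ndF/leq_maxl.
  - by move: Gj; exact/subsetPset/ndG/leq_maxr.
have [mFk Fk] := Foo k; have [mGk Gk] := Goo k; split.
  by rewrite -[X in measurable X]setTI; apply: mg => //; exact: measurableX.
rewrite /lebesgue_cons /pushforward -comp_preimage.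
rewrite (_ : g \o _ = id) ?preimage_id; last by rewrite funeqE => p; exact: gK.
by rewrite product_measure1E// lte_mul_pinfty// ge0_fin_numE.
Qed.

HB.instance Definition _ := Measure_isSigmaFinite.Build _ _ _
  (lebesgue_cons mu) lebesgue_cons_sigma_finite.

End lebesgue_cons_measure.

(* The n-fold product of the Lebesgue measure on R; [lebesgue_measureRV_box]
   gives its values on boxes, which determine it. *)
Fixpoint lebesgue_measureRV n :
    {sigma_finite_measure set (borelRV R n) -> \bar R} :=
  if n is m.+1 then lebesgue_cons (lebesgue_measureRV m)
  else @dirac _ (borelRV R 0) (0 : 'rV[R]_0) R.

Lemma lebesgue_measureRV_box n (a b : 'rV[R]_n) :
  (forall i, a ord0 i <= b ord0 i) ->
  lebesgue_measureRV n
    [set v : 'rV[R]_n | forall i, a ord0 i <= v ord0 i <= b ord0 i] =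
  (\prod_(i < n) (b ord0 i - a ord0 i))%:E.
Proof.
elim: n a b => [|n IH] a b ab.
  rewrite big_ord0 /= diracE mem_set//; first by move=> i; case: i.
pose tl (v : 'rV[R]_n.+1) : 'rV[R]_n := \row_j v ord0 (lift ord0 j).
rewrite big_ord_recl EFinM.
have := IH (tl a) (tl b); under eq_bigr do rewrite !mxE.
move=> <-; last by move=> i; rewrite !mxE.
rewrite /= /lebesgue_cons /pushforward.
set B := (X in (_ * lebesgue_measureRV n X)%E).
have -> : @rv_cons n @^-1` [set v : 'rV[R]_n.+1 |
    forall i, a ord0 i <= v ord0 i <= b ord0 i] =
    `[a ord0 ord0, b ord0 ord0]%classic `*` (B : set (borelRV R n)).
  apply/seteqP; split => [[x v] /= h|[x v] /= [x_ab vB] i].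
    split=> [|i]; first by have := h ord0; rewrite !mxE unlift_none in_itv.
    by have := h (lift ord0 i); rewrite !mxE liftK.
  case: (unliftP ord0 i) => [j ->|->].
    by have := vB j; rewrite !mxE liftK.
  by rewrite mxE unlift_none /=; rewrite in_itv in x_ab.
rewrite product_measure1E//; last first.
  rewrite (_ : B = \bigcap_(j in [set: 'I_n])
    ((fun v : borelRV R n => (v : 'rV[R]_n) ord0 j : R) @^-1`
      `[tl a ord0 j, tl b ord0 j]%classic)); last first.
    by apply/seteqP; split => x /= h j; [move=> _|];
      have := h j; rewrite /= in_itv /=; [|exact].
  apply: fin_bigcap_measurable => [|j _]; first exact: finite_finset.
  by rewrite -[X in measurable X]setTI; exact: measurable_coord.
congr (_ * _)%E; rewrite /= lebesgue_measure_itv /= lte_fin.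
by case: ltgtP (ab ord0) => // ->; rewrite subrr.
Qed.

End borel_row_vectors.

Section star_bodies.
Context {R : realType} (n : nat).
Implicit Types (K : set 'rV[R]_n) (V : 'rV[R]_n -> R).

Definition homogeneous (p : R) V :=
  forall (l : R) (x : 'rV[R]_n), 0 < l -> V (l *: x) = l `^ p * V x.

Definition star_body K :=
  measurable (K : set (borelRV R n)) /\
  forall (x : 'rV[R]_n) (l : R), K x -> 0 <= l <= 1 -> K (l *: x).

Definition minkowski_average (t : R) K0 K1 : set 'rV[R]_n :=
  [set (1 - t) *: x + t *: y | x in K0 & y in K1].

End star_bodies.

(* Main.v *)
(**
  Let [s = p / (p - 1)]. The Prekopa-Leindler inequality with a weight [th],
  applied to the densities of [nu] on the dilates [m0 K0] and [m1 K1], gives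
    [nu ((1-t) K0 + t K1) >= (m0^n nu K0)^(1-th) (m1^n nu K1)^th]
  as soon as [(1-th) m0 <= 1-t] and [th m1 <= t] (so that the star bodies absorb
  the slack) and [(1-th) m0^s + th m1^s = 1] (so that homogeneity and convexity
  give [V ((1-th) m0 x + th m1 y) <= (1-th) V x + th V y]). With
  [X_i = (nu K_i)^(1/(n s))], [X_0 <= X_1] and [Y = (1-t) X_0 + t X_1], the choice
  [m1 = Y / X_1], [th = t / m1] makes the right-hand side at least [Y^(n s)]: this
  is a one-variable inequality for [m1] in (0, 1], with equality at [m1 = 1],
  proved by differentiation and Bernoulli's inequality.
*)

Require Import Defs.
From mathcomp Require Import all_boot all_order all_algebra.
From mathcomp Require Import all_classical all_reals all_analysis.
From mathcomp Require Import measurable_realfun ring lra.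

Set Implicit Arguments.
Unset Strict Implicit.
Unset Printing Implicit Defensive.

Import Order.TTheory GRing.Theory Num.Theory.
Import numFieldNormedType.Exports.
Local Open Scope classical_set_scope.
Local Open Scope ring_scope.

(** * Brunn-Minkowski inequality on the line *)

Lemma lebesgue_measure_affine (R : realType) (s a : R) (A : set R) :
  0 < s -> measurable A ->
  lebesgue_measure A = (s%:E * lebesgue_measure [set x | A (s * x + a)%R])%E.
Proof.
move=> s0 mA.
pose T := measurableTypeR R.
pose phi (x : T) : T := s * x + a.
have mphi : measurable_fun setT phi by apply: measurable_funD.
pose k := NngNum (ltW s0).
pose mu1 : {measure set T -> \bar R} := mscale k
  (measure_function_pushforward__canonical__measure_function_Measure
     (@lebesgue_measure R) mphi).
rewrite (@lebesgue_measure_unique _ mu1)// => _ [[c d] _ <-].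
rewrite /mu1 /= /mscale /= /pushforward.
have -> : phi @^-1` `]c, d] = `](c - a) / s, (d - a) / s]%classic.
  by apply/seteqP; split => x; rewrite /phi /= !in_itv /=;
    rewrite ler_pdivlMr// ltr_pdivrMr// ltrBlDr lerBrDr (mulrC x).
rewrite !lebesgue_measure_itv /= !lte_fin ltr_pM2r ?invr_gt0// ltrD2r.
case: ifP => _; last by rewrite mule0.
by rewrite -EFinD -EFinM; congr EFin; field; rewrite gt_eqF.
Qed.

(* Two compact sets translated so that the maximum of the first meets the
   minimum of the second overlap in a single point. *)
Lemma lebesgue_measure_add_compact (R : realType) (A0 A1 B : set R) :
  compact A0 -> compact A1 -> A0 !=set0 -> A1 !=set0 -> measurable B ->
  (forall x y, A0 x -> A1 y -> B (x + y)) ->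
  (lebesgue_measure A0 + lebesgue_measure A1 <= lebesgue_measure B)%E.
Proof.
move=> c0 c1 n0 n1 mB AB.
have cid_ (A : set R) : {within A, continuous (@idfun R)}.
  by apply: continuous_subspaceT => x; exact: cvg_id.
have [a /set_mem aA amax] := compact_EVT_max n0 c0 (cid_ A0).
have [b /set_mem bA bmin] := compact_EVT_min n1 c1 (cid_ A1).
have m0 := compact_measurable c0; have m1 := compact_measurable c1.
rewrite [X in (X + _)%E](@lebesgue_measure_affine _ 1 (- b))// mul1e.
rewrite [X in (_ + X)%E](@lebesgue_measure_affine _ 1 (- a))// mul1e.
set C0 := [set x | _]; set C1 := [set x | A1 _].
have mC0 : measurable C0.
  have : measurable_fun setT (fun x : R => 1 * x - b) by exact: measurable_funD.
  by move=> /(_ measurableT _ m0); rewrite setTI.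
have mC1 : measurable C1.
  have : measurable_fun setT (fun x : R => 1 * x - a) by exact: measurable_funD.
  by move=> /(_ measurableT _ m1); rewrite setTI.
have sub : C0 `&` C1 `<=` [set a + b].
  move=> x [/= x0 x1]; have /= := amax _ (mem_set x0).
  have /= := bmin _ (mem_set x1); rewrite !mul1r lerBrDr lerBlDr => h1 h2.
  by apply/eqP; rewrite eq_le h2 addrC.
have C010 : lebesgue_measure (C0 `&` C1) = 0%E.
  apply: (@subset_measure0 _ _ _ lebesgue_measure _ [set (a + b)]) => //.
    exact: measurableI.
  exact: lebesgue_measure_set1.
have -> : (lebesgue_measure C0 = lebesgue_measure (C0 `\` C1))%E.
  have {1}-> : C0 = (C0 `\` C1) `|` (C0 `&` C1) by rewrite setUC setUIDK.
  rewrite measureU//.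
  - by rewrite [X in (_ + X)%E]C010 adde0.
  - exact: measurableD.
  - exact: measurableI.
  - by rewrite setIACA setICl setI0.
have mD : measurable (C0 `\` C1) by exact: measurableD.
rewrite -measureU//; last by rewrite setDE -setIA setICl setI0.
apply: le_measure; rewrite ?inE//; first exact: measurableU.
move=> x [[x0 _]|x1].
  by have := AB _ _ x0 bA; rewrite mul1r subrK.
by have := AB _ _ aA x1; rewrite mul1r addrC subrK.
Qed.

(** Lets a sum be bounded by testing reals strictly below one summand, so that finite and infinite
    measures are approximated from inside in the same way. *)
Lemma lee_add_lt_sup (R : realType) (a b c : \bar R) :
  (0 <= a)%E -> b != -oo%E ->
  (forall u : R, u%:E < a -> u%:E + b <= c)%E -> (a + b <= c)%E.
Proof.
case: a => [r| |] // r0 b0 h.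
  apply/lee_addgt0Pr => e e0.
  rewrite -leeBlDr// addeAC -EFinB; apply: h.
  by rewrite lte_fin ltrBlDr ltrDl.
case: b b0 h => [s| |]// _ h; last by have := h 0 (ltry _).
case: c h => [t| |] h; rewrite ?leey//; exfalso; last by have := h 0 (ltry _).
have := h (t - s + 1) (ltry _); rewrite -EFinD lee_fin; apply/negP; rewrite -ltNge.
by rewrite addrAC subrK ltrDl.
Qed.

(** Inner regularity reduces the claim to compact subsets of [A0] and [A1], and the two suprema are
    then taken one after the other. *)
Lemma lebesgue_measure_add (R : realType) (A0 A1 B : set R) :
  measurable A0 -> measurable A1 -> A0 !=set0 -> A1 !=set0 -> measurable B ->
  (forall x y, A0 x -> A1 y -> B (x + y)) ->
  (lebesgue_measure A0 + lebesgue_measure A1 <= lebesgue_measure B)%E.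
Proof.
move=> m0 m1 n0 n1 mB AB.
have cpt (A : set R) u : measurable A -> A !=set0 -> (u%:E < lebesgue_measure A)%E ->
    exists K, [/\ compact K, K !=set0, K `<=` A & (u%:E < lebesgue_measure K)%E].
  move=> mA [a Aa]; rewrite lebesgue_regularity_inner_sup// => /ereal_sup_gt.
  move=> [_ [K [cK KA] <-] uK].
  (* An empty [K] occurs only for [u < 0]; a singleton, also of measure 0, replaces it. *)
  have [K0|/set0P K0] := eqVneq K set0; last by exists K.
  exists [set a]; split => //; first exact: compact_set1.
  - by exists a.
  - by move=> _ ->.
  - by rewrite lebesgue_measure_set1; move: uK; rewrite K0 measure0.
have add_lt u v : (u%:E < lebesgue_measure A0 -> v%:E < lebesgue_measure A1 ->
    u%:E + v%:E <= lebesgue_measure B)%E.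
  move=> /cpt[]// K [cK nK KA uK] /cpt[]// L [cL nL LA vL].
  apply: (@le_trans _ _ (lebesgue_measure K + lebesgue_measure L)%E).
    by rewrite leeD// ltW.
  by apply: lebesgue_measure_add_compact => // x y /KA Ax /LA; exact: AB.
apply: lee_add_lt_sup => // [|u uA]; first by rewrite -ltNye; exact: (lt_le_trans (ltNyr 0)).
by rewrite addeC; apply: lee_add_lt_sup => // v vA; rewrite addeC; exact: add_lt.
Qed.

(** * Layer-cake formula for nonnegative functions *)

Section layer_cake.
Context d (T : measurableType d) (R : realType).
Variables (mu : {sigma_finite_measure set T -> \bar R}) (f : T -> \bar R).
Hypotheses (mf : measurable_fun setT f) (f0 : forall x, (0 <= f x)%E).

Let hypograph : set (T * measurableTypeR R) :=
  [set z | 0 <= z.2 /\ (z.2%:E < f z.1)%E].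

Let measurable_hypograph : measurable hypograph.
Proof.
rewrite (_ : hypograph = [set z | 0 <= z.2] `&` [set z | z.2%:E < f z.1]%E)//.
apply: measurableI.
  have : measurable_fun setT (snd : T * measurableTypeR R -> measurableTypeR R) by [].
  move=> /(_ measurableT `[0, +oo[%classic); rewrite setTI => h.
  by have := h (measurable_itv _); congr measurable; apply/seteqP; split => z /=;
    rewrite in_itv /= andbT.
rewrite -[X in measurable X]setTI; apply: measurable_lte => //.
  exact/measurable_EFinP.
exact: measurableT_comp.
Qed.

(** Tonelli for the indicator of the region between 0 and the graph of [f]. Keeping [0 <= r] inside
    the level set lets the outer integral run over the whole line. *)
Lemma layer_cake :
  (\int[mu]_x f x =
   \int[lebesgue_measure]_r mu [set x | (0 <= r)%R /\ (r%:E < f x)%E])%E.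
Proof.
pose g (z : T * measurableTypeR R) := (\1_hypograph z)%:E : \bar R.
have mg : measurable_fun setT g by apply/measurable_EFinP; exact: measurable_indic.
have g0 z : (0 <= g z)%E by rewrite lee_fin.
have := @fubini_tonelli _ _ _ _ _ mu (@lebesgue_measure R) g mg g0.
rewrite /g => fub.
transitivity (\int[mu]_x \int[lebesgue_measure]_r (\1_hypograph (x, r))%:E)%E.
  apply: eq_integral => x _.
  pose S := [set r : measurableTypeR R | 0 <= r /\ (r%:E < f x)%E].
  have mS : measurable S.
    have := measurable_xsection x measurable_hypograph.
    by congr measurable; apply/seteqP; split => r; rewrite /xsection /= inE.
  rewrite (eq_integral (fun r => (\1_S r)%:E)); last first.
    by move=> r _; rewrite !indicE; congr (_%:R%:E); apply/idP/idP; rewrite !inE.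
  rewrite integral_indic// setIT.
  have := f0 x; rewrite /S; case: (f x) => [s s0| _|//].
    rewrite (_ : [set _ | _] = `[0, s[%classic); last first.
      by apply/seteqP; split => r /=; rewrite in_itv /= lte_fin => /andP.
    rewrite [RHS]lebesgue_measure_itv /= lte_fin; case: ltP => [_|s1].
      by rewrite oppr0 adde0.
    by apply/eqP; rewrite eq_le s0 !lee_fin s1.
  rewrite (_ : [set _ | _] = `[0, +oo[%classic); last first.
    apply/seteqP; split => r /=; rewrite in_itv /= andbT; first by case.
    by move=> ->; rewrite ltry.
  by rewrite [RHS]lebesgue_measure_itv /= ltry.
rewrite fub; apply: eq_integral => r _.
pose S := [set x | 0 <= r /\ (r%:E < f x)%E].
have mS : measurable S.
  have := measurable_ysection r measurable_hypograph.
  by congr measurable; apply/seteqP; split => z; rewrite /ysection /= inE.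
rewrite (eq_integral (fun x => (\1_S x)%:E)); last first.
  by move=> x _; rewrite !indicE; congr (_%:R%:E); apply/idP/idP; rewrite !inE.
by rewrite integral_indic// setIT.
Qed.

Lemma measurable_layer_cake :
  measurable_fun setT (fun r : measurableTypeR R =>
    mu [set x | (0 <= r)%R /\ (r%:E < f x)%E]).
Proof.
have := measurable_fun_ysection mu measurable_hypograph.
congr measurable_fun; apply/funext => r /=; congr (mu _).
by apply/seteqP; split => z; rewrite /ysection /= inE.
Qed.

End layer_cake.

(** * Prekopa-Leindler inequality on the line *)

Lemma lebesgue_measure_convex_comb (R : realType) (th : R) (A0 A1 B : set R) :
  0 < th < 1 ->
  measurable A0 -> measurable A1 -> A0 !=set0 -> A1 !=set0 -> measurable B ->
  (forall x y, A0 x -> A1 y -> B ((1 - th) * x + th * y)) ->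
  ((1 - th)%:E * lebesgue_measure A0 + th%:E * lebesgue_measure A1 <=
   lebesgue_measure B)%E.
Proof.
move=> /andP[th0 th1] m0 m1 [a aA] [b bA] mB AB.
(* This preimage is the dilate of [A] by [s]; the additive inequality is applied to the dilates by
   [1 - th] and [th]. *)
have scaled (s : R) (A : set R) : 0 < s -> measurable A ->
    measurable [set x | A (s^-1 * x + 0)] /\
    (s%:E * lebesgue_measure A = lebesgue_measure [set x | A (s^-1 * x + 0)%R])%E.
  move=> s0 mA; split.
    have : measurable_fun setT (fun x : R => s^-1 * x + 0) by exact: measurable_funD.
    by move=> /(_ measurableT _ mA); rewrite setTI.
  rewrite (@lebesgue_measure_affine _ s^-1 0)// ?invr_gt0// muleA -EFinM.
  by rewrite divff ?gt_eqF// mul1e.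
have th1' : 0 < 1 - th by rewrite subr_gt0.
have [n0 ->] := scaled _ _ th1' m0.
have [n1 ->] := scaled _ _ th0 m1.
apply: lebesgue_measure_add => //.
- by exists ((1 - th) * a); rewrite /= addr0 mulKf ?gt_eqF.
- by exists (th * b); rewrite /= addr0 mulKf ?gt_eqF.
- move=> x y /= Ax Ay; have := AB _ _ Ax Ay.
  by rewrite !addr0 !mulVKf ?gt_eqF.
Qed.

(** With both suprema equal to 1, the superlevel sets of [f] and [g] are nonempty at exactly the
    same levels, so the set inequality holds level by level. The layer-cake formula integrates it,
    which yields an arithmetic mean on the left. *)
Lemma prekopa_leindler1_normalized (R : realType) (th : R)
    (f g h : measurableTypeR R -> \bar R) :
  0 < th < 1 ->
  measurable_fun setT f -> measurable_fun setT g -> measurable_fun setT h ->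
  (forall x, 0 <= f x <= 1)%E -> (forall x, 0 <= g x <= 1)%E ->
  (forall x, 0 <= h x)%E ->
  (forall r : R, r < 1 -> exists x, (r%:E < f x)%E) ->
  (forall r : R, r < 1 -> exists x, (r%:E < g x)%E) ->
  (forall (r : R) x y, 0 <= r -> (r%:E < f x)%E -> (r%:E < g y)%E ->
     (r%:E < h ((1 - th) * x + th * y)%R)%E) ->
  ((1 - th)%:E * (\int[lebesgue_measure]_x f x) +
   th%:E * (\int[lebesgue_measure]_x g x) <= \int[lebesgue_measure]_x h x)%E.
Proof.
move=> /andP[th0 th1] mf mg mh f01 g01 h0 supf supg fgh.
have th1' : 0 < 1 - th by rewrite subr_gt0.
have f0 x : (0 <= f x)%E by case/andP: (f01 x).
have g0 x : (0 <= g x)%E by case/andP: (g01 x).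
rewrite (layer_cake lebesgue_measure mf f0) (layer_cake lebesgue_measure mg g0).
rewrite (layer_cake lebesgue_measure mh h0).
rewrite -!ge0_integralZl//; first last.
  1,3: by rewrite lee_fin ltW.
  1,2: exact: measurable_layer_cake.
rewrite -ge0_integralD//; first last.
  1,3: by apply: measurable_funeM; exact: measurable_layer_cake.
  1,2: by move=> r _; rewrite mule_ge0// lee_fin ltW.
apply: ge0_le_integral => //.
- by move=> r _; rewrite adde_ge0// mule_ge0// lee_fin ltW.
- by apply: emeasurable_funD; apply: measurable_funeM; exact: measurable_layer_cake.
- exact: measurable_layer_cake.
move=> r _ /=.
have mS (k : measurableTypeR R -> \bar R) : measurable_fun setT k ->
    measurable [set x | 0 <= r /\ (r%:E < k x)%E].
  move=> mk; have [r0|r0] := leP 0 r; last first.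
    by rewrite (_ : [set _ | _] = set0)//; apply/seteqP; split => x /= [].
  rewrite (_ : [set _ | _] = [set x | cst r%:E x < k x]%E); last first.
    by apply/seteqP; split => x /= => [[]|].
  by rewrite -[X in measurable X]setTI; exact: measurable_lte.
have [r0|] := boolP (r < 0).
  have S0 (k : measurableTypeR R -> \bar R) :
      [set x | 0 <= r /\ (r%:E < k x)%E] = set0.
    by apply/seteqP; split => // x /= []; rewrite leNgt r0.
  by rewrite !S0 !measure0 !mule0 adde0.
(* From level 1 on, the level sets of [f] and [g] are empty and the left side is 0. *)
rewrite -leNgt => r0; have [r1|r1] := ltP r 1; last first.
  have S0 (k : measurableTypeR R -> \bar R) : (forall x, 0 <= k x <= 1)%E ->
      [set x | 0 <= r /\ (r%:E < k x)%E] = set0.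
    move=> k01; apply/seteqP; split => // x /= [_]; apply/negP; rewrite -leNgt.
    by case/andP: (k01 x) => _ /le_trans; apply; rewrite lee_fin.
  by rewrite (S0 f)// (S0 g)// !measure0 !mule0 adde0 measure_ge0.
apply: lebesgue_measure_convex_comb; rewrite ?th0//; try exact: mS.
- by have [x] := supf _ r1; exists x.
- by have [x] := supg _ r1; exists x.
- by move=> x y /= [_ fx] [_ gy]; split => //; exact: fgh.
Qed.

(** Young's inequality for the conjugate exponents [(1 - th)^-1] and [th^-1]. *)
Lemma powR_weighted_amgm (R : realType) (th u v : R) :
  0 < th < 1 -> 0 <= u -> 0 <= v ->
  u `^ (1 - th) * v `^ th <= (1 - th) * u + th * v.
Proof.
move=> /andP[th0 th1] u0 v0; have th1' : 0 < 1 - th by rewrite subr_gt0.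
have := @conjugate_powR _ (u `^ (1 - th)) (v `^ th) (1 - th)^-1 th^-1.
rewrite !powR_ge0 !invr_gt0 !invrK subrK -!powRrM => /(_ isT isT th1' th0 erefl).
by rewrite !divff ?gt_eqF// !powRr1// (mulrC u) (mulrC v).
Qed.

(* [c] dominates the weighted geometric mean of [a] and [b]. Testing on reals
   strictly below [a] and [b] avoids the products [0 * +oo]. *)
Definition gm_le (R : realType) (th : R) (a b c : \bar R) : Prop :=
  forall u v : R, 0 < u -> 0 < v -> (u%:E < a)%E -> (v%:E < b)%E ->
  ((u `^ (1 - th) * v `^ th)%:E <= c)%E.

(** Dividing [f] and [g] by their suprema [a] and [b], and [h] by the geometric mean [M] of these,
    gives the normalized case; the arithmetic mean obtained there dominates the geometric one. *)
Lemma prekopa_leindler1_bounded (R : realType) (th k : R)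
    (f g : measurableTypeR R -> R) (h : measurableTypeR R -> \bar R) :
  0 < th < 1 ->
  measurable_fun setT f -> measurable_fun setT g -> measurable_fun setT h ->
  (forall x, 0 <= f x <= k) -> (forall x, 0 <= g x <= k) ->
  (forall x, 0 <= h x)%E ->
  (forall x y, gm_le th (f x)%:E (g y)%:E (h ((1 - th) * x + th * y))) ->
  gm_le th (\int[lebesgue_measure]_x (f x)%:E)%E
    (\int[lebesgue_measure]_x (g x)%:E)%E (\int[lebesgue_measure]_x h x)%E.
Proof.
move=> th01 mf mg mh f0k g0k h0 fgh u v u0 v0 uf vg.
have /andP[th0 th1] := th01; have th1' : 0 < 1 - th by rewrite subr_gt0.
have sup_gt0 (F : measurableTypeR R -> R) w : (forall x, 0 <= F x <= k) -> 0 < w ->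
    (w%:E < \int[lebesgue_measure]_x (F x)%:E)%E ->
    exists a, [/\ 0 < a, forall x, F x <= a & forall r, r < a -> exists x, r < F x].
  move=> Fk w0 wF.
  have sF : has_sup (range F).
    split; first by exists (F 0), 0.
    by exists k => _ [x _ <-]; case/andP: (Fk x).
  have Fle x : F x <= sup (range F) by apply: sup_upper_bound => //; exists x.
  exists (sup (range F)); split => //; last first.
    by move=> r /(sup_gt sF.1)[_ [x _ <-] rF]; exists x.
  (* A nonpositive supremum would make [F] vanish, against the positive lower bound [w] on its
     integral. *)
  rewrite ltNge; apply/negP => s0.
  suff : (\int[lebesgue_measure]_x (F x)%:E = 0)%E.
    by move=> F0; move: wF; rewrite F0 lte_fin ltNge (ltW w0).
  apply: integral0_eq => x _; congr EFin.
  by apply/eqP; rewrite eq_le (le_trans (Fle x) s0); case/andP: (Fk x).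
have [a [a0 fa asup]] := sup_gt0 _ _ f0k u0 uf.
have [b [b0 gb bsup]] := sup_gt0 _ _ g0k v0 vg.
pose M := a `^ (1 - th) * b `^ th.
have M0 : 0 < M by rewrite mulr_gt0// powR_gt0.
have normE c (F : measurableTypeR R -> R) : 0 < c -> measurable_fun setT F ->
    (forall x, 0 <= F x <= k) ->
    (\int[lebesgue_measure]_x (c^-1%:E * (F x)%:E) =
     c^-1%:E * \int[lebesgue_measure]_x (F x)%:E)%E.
  move=> c0 mF Fk; rewrite ge0_integralZl//.
  - exact/measurable_EFinP.
  - by move=> x _; rewrite lee_fin; case/andP: (Fk x).
  - by rewrite lee_fin invr_ge0 ltW.
have norm01 c (F : measurableTypeR R -> R) : 0 < c -> (forall x, 0 <= F x <= k) ->
    (forall x, F x <= c) -> forall x, (0 <= c^-1%:E * (F x)%:E <= 1)%E.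
  move=> c0 Fk Fc x; rewrite -EFinM !lee_fin; case/andP: (Fk x) => F0 _.
  by rewrite mulr_ge0 ?invr_ge0 ?(ltW c0)//= mulrC ler_pdivrMr// mul1r.
have := @prekopa_leindler1_normalized _ th (fun x => a^-1%:E * (f x)%:E)%E
  (fun x => b^-1%:E * (g x)%:E)%E (fun x => M^-1%:E * h x)%E th01.
rewrite !normE// ge0_integralZl//; last by rewrite lee_fin invr_ge0 ltW.
move=> /(_ _ _ _ (norm01 _ _ a0 f0k fa) (norm01 _ _ b0 g0k gb)) PL.
have {}PL : ((1 - th)%:E * (a^-1%:E * \int[lebesgue_measure]_x (f x)%:E) +
   th%:E * (b^-1%:E * \int[lebesgue_measure]_x (g x)%:E) <=
   M^-1%:E * \int[lebesgue_measure]_x h x)%E.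
  apply: PL.
  - by apply: measurable_funeM; exact/measurable_EFinP.
  - by apply: measurable_funeM; exact/measurable_EFinP.
  - exact: measurable_funeM.
  - by move=> x; rewrite mule_ge0// lee_fin invr_ge0 ltW.
  - move=> r r1; have : r * a < a by rewrite gtr_pMl.
    by move=> /asup[x]; exists x; rewrite lte_fin mulrC ltr_pdivlMr.
  - move=> r r1; have : r * b < b by rewrite gtr_pMl.
    by move=> /bsup[x]; exists x; rewrite lte_fin mulrC ltr_pdivlMr.
  - move=> r x y r0; rewrite !lte_fin mulrC ltr_pdivlMr// => rf.
    rewrite mulrC ltr_pdivlMr// => rg.
    (* The hypothesis on [h] is tested at reals strictly below [f x] and [g y]. Midpoints also stay
       strictly above [r * a] and [r * b], which makes the resulting bound on [h] strict. *)
    have [u1 /andP[ru1 u1f]] : exists u1, r * a < u1 < f x.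
      by exists ((r * a + f x) / 2); rewrite !midf_lt.
    have [v1 /andP[rv1 v1g]] : exists v1, r * b < v1 < g y.
      by exists ((r * b + g y) / 2); rewrite !midf_lt.
    have ra0 : 0 <= r * a by rewrite mulr_ge0// ltW.
    have rb0 : 0 <= r * b by rewrite mulr_ge0// ltW.
    have u10 := le_lt_trans ra0 ru1; have v10 := le_lt_trans rb0 rv1.
    rewrite lte_pdivlMl//; apply: lt_le_trans (fgh x y u1 v1 u10 v10 _ _) => //.
    rewrite -EFinM lte_fin /M.
    have -> : (a `^ (1 - th) * b `^ th) * r = (r * a) `^ (1 - th) * (r * b) `^ th.
      rewrite !powRM ?(ltW a0) ?(ltW b0)// mulrC mulrACA; congr (_ * _).
      by rewrite -powRD ?subrK ?powRr1// oner_eq0.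
    by apply: ltr_pM; rewrite ?powR_ge0// gt0_ltr_powR// ?nnegrE// ltW.
have -> : u `^ (1 - th) * v `^ th = M * ((a^-1 * u) `^ (1 - th) * (b^-1 * v) `^ th).
  rewrite /M mulrACA -!powRM ?mulr_ge0 ?invr_ge0 ?(ltW a0) ?(ltW b0) ?(ltW u0) ?(ltW v0)//.
  by rewrite !mulVKf ?gt_eqF.
rewrite EFinM -lee_pdivlMl//; apply: le_trans PL.
apply: (@le_trans _ _ ((1 - th) * (a^-1 * u) + th * (b^-1 * v))%:E).
  by rewrite lee_fin powR_weighted_amgm// mulr_ge0// ?invr_ge0 ltW.
rewrite EFinD !EFinM; apply: leeD.
  by do 2 (apply: lee_wpmul2l; first by rewrite lee_fin ?invr_ge0 ltW); exact: ltW.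
by do 2 (apply: lee_wpmul2l; first by rewrite lee_fin ?invr_ge0 ltW); exact: ltW.
Qed.

Import HBNNSimple.

Lemma lt_integral_nnsfun d (T : measurableType d) (R : realType)
    (mu : {measure set T -> \bar R}) (f : T -> \bar R) (w : R) :
  (forall x, 0 <= f x)%E -> (w%:E < \int[mu]_x f x)%E ->
  exists s : {nnsfun T >-> R},
    (forall x, (s x)%:E <= f x)%E /\ (w%:E < \int[mu]_x (s x)%:E)%E.
Proof.
move=> f0; rewrite ge0_integralTE// => /ereal_sup_gt[_ [s sf <-] ws].
by exists s; rewrite integralT_nnsfun.
Qed.

Lemma nnsfun_bounded d (T : measurableType d) (R : realType)
    (s : {nnsfun T >-> R}) : exists k, forall x, 0 <= s x <= k.
Proof.
have [M [_ /= bdM]] := simple_bounded s.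
exists (M + 1) => x; rewrite fun_ge0 /=.
by rewrite (le_trans (ler_norm _))// bdM// ltrDl.
Qed.

(** Since [gm_le] tests reals strictly below the integrals, simple functions under [f] and [g]
    already exceed the test values, and these are bounded. *)
Lemma prekopa_leindler1 (R : realType) (th : R)
    (f g h : measurableTypeR R -> \bar R) :
  0 < th < 1 ->
  measurable_fun setT h ->
  (forall x, 0 <= f x)%E -> (forall x, 0 <= g x)%E -> (forall x, 0 <= h x)%E ->
  (forall x y, gm_le th (f x) (g y) (h ((1 - th) * x + th * y))) ->
  gm_le th (\int[lebesgue_measure]_x f x)%E
    (\int[lebesgue_measure]_x g x)%E (\int[lebesgue_measure]_x h x)%E.
Proof.
move=> th01 mh f0 g0 h0 fgh u v u0 v0.
move=> /(lt_integral_nnsfun f0)[s [sf us]] /(lt_integral_nnsfun g0)[s' [s'g vs']].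
have [k sk] := nnsfun_bounded s; have [k' s'k'] := nnsfun_bounded s'.
apply: (@prekopa_leindler1_bounded _ th (Num.max k k') s s') => //.
- by move=> x; case/andP: (sk x) => -> /=; rewrite le_max => ->.
- by move=> x; case/andP: (s'k' x) => -> /=; rewrite le_max orbC => ->.
- move=> x y a b a0 b0 /lt_le_trans-/(_ _ (sf x)) af /lt_le_trans-/(_ _ (s'g y)) bg.
  exact: fgh.
Qed.

(** * Prekopa-Leindler inequality and change of scale in dimension n *)

Section lebesgue_measureRV_integral.
Context {R : realType}.
Implicit Types n : nat.

Lemma rv_cons_lincomb n (a b s s' : R) (v v' : 'rV[R]_n) :
  rv_cons (a * s + b * s', (a *: v + b *: v') : borelRV R n) =
  a *: (rv_cons (s, v : borelRV R n) : 'rV[R]_n.+1) +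
  b *: (rv_cons (s', v' : borelRV R n) : 'rV[R]_n.+1).
Proof.
apply/rowP => i; rewrite !mxE; case: (unlift ord0 i) => [j|] //=.
by rewrite !mxE.
Qed.

Lemma integral_rv_cons n (f : borelRV R n.+1 -> \bar R) :
  measurable_fun setT f -> (forall x, 0 <= f x)%E ->
  (\int[lebesgue_measureRV n.+1]_x f x =
   \int[lebesgue_measure]_s \int[lebesgue_measureRV n]_v f (rv_cons (s, v)))%E.
Proof.
move=> mf f0; rewrite /= /lebesgue_cons.
rewrite ge0_integral_pushforward//; last exact: measurable_rv_cons.
rewrite preimage_setT fubini_tonelli1// => [|x]; last exact: f0.
by apply: measurableT_comp => //; exact: measurable_rv_cons.
Qed.

Lemma measurable_integral_rv_cons n (f : borelRV R n.+1 -> \bar R) :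
  measurable_fun setT f -> (forall x, 0 <= f x)%E ->
  measurable_fun setT (fun s : measurableTypeR R =>
    \int[lebesgue_measureRV n]_v f (rv_cons (s, v)))%E.
Proof.
move=> mf f0.
apply: (@measurable_fun_fubini_tonelli_F _ _ _ _ _ (lebesgue_measureRV n)
  (f \o @rv_cons R n)) => //=.
by apply: measurableT_comp => //; exact: measurable_rv_cons.
Qed.

(** Induction on the dimension: for fixed first coordinates [s] and [s'], the inequality on the
    fibres is exactly the hypothesis of the one-dimensional case for the fibre integrals. *)
Lemma prekopa_leindler n (th : R) (f g h : borelRV R n -> \bar R) :
  0 < th < 1 ->
  measurable_fun setT f -> measurable_fun setT g -> measurable_fun setT h ->
  (forall x, 0 <= f x)%E -> (forall x, 0 <= g x)%E -> (forall x, 0 <= h x)%E ->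
  (forall x y : 'rV[R]_n, gm_le th (f x) (g y) (h ((1 - th) *: x + th *: y))) ->
  gm_le th (\int[lebesgue_measureRV n]_x f x)%E
    (\int[lebesgue_measureRV n]_x g x)%E (\int[lebesgue_measureRV n]_x h x)%E.
Proof.
move=> th01; elim: n f g h => [|n IH] f g h mf mg mh f0 g0 h0 fgh.
  rewrite /= !integral_dirac// !diracE !mem_set// !mul1e.
  by have := fgh 0 0; rewrite !scaler0 addr0.
rewrite (integral_rv_cons mf f0) (integral_rv_cons mg g0) (integral_rv_cons mh h0).
have mcons (k : borelRV R n.+1 -> \bar R) s : measurable_fun setT k ->
    measurable_fun setT (fun v : borelRV R n => k (rv_cons (s, v))).
  move=> mk; apply: measurableT_comp => //.
  apply: (@measurableT_comp _ _ _ _ _ _ (@rv_cons R n)); first exact: measurable_rv_cons.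
  exact: measurable_pair1.
apply: prekopa_leindler1 => //.
- exact: measurable_integral_rv_cons.
- by move=> s; exact: integral_ge0.
- by move=> s; exact: integral_ge0.
- by move=> s; exact: integral_ge0.
move=> s s'; apply: IH; rewrite ?th01//; try exact: mcons.
by move=> v v'; rewrite rv_cons_lincomb; exact: fgh.
Qed.

Lemma measurable_scalerv n (m : R) :
  measurable_fun setT (fun v : borelRV R n => (m *: (v : 'rV[R]_n)) : borelRV R n).
Proof.
apply: measurable_fun_coordP => j.
under eq_fun do rewrite mxE.
by apply: measurable_funM => //; exact: measurable_coord.
Qed.

Lemma lebesgue_integral_scale (m : R) (f : measurableTypeR R -> \bar R) :
  0 < m -> measurable_fun setT f -> (forall x, 0 <= f x)%E ->
  (\int[lebesgue_measure]_s f s =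
   m%:E * \int[lebesgue_measure]_s f (m * s)%R)%E.
Proof.
move=> m0 mf f0; pose T := measurableTypeR R.
pose phi (x : T) : T := m * x + 0.
have mphi : measurable_fun setT phi by exact: measurable_funD.
pose P := measure_function_pushforward__canonical__measure_function_Measure
     (@lebesgue_measure R) mphi.
rewrite (@eq_measure_integral _ _ _ _ (mscale (NngNum (ltW m0)) P)).
  rewrite ge0_integral_mscale// /P /= ge0_integral_pushforward//.
  rewrite preimage_setT; congr (_ * _)%E; apply: eq_integral => x _ /=.
  by rewrite /phi addr0.
by move=> A mA _; exact: (@lebesgue_measure_affine _ m 0 A m0 mA).
Qed.

Lemma lebesgue_measureRV_scale n (m : R) (f : borelRV R n -> \bar R) :
  0 < m -> measurable_fun setT f -> (forall x, 0 <= f x)%E ->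
  (\int[lebesgue_measureRV n]_x f x =
   (m ^+ n)%:E * \int[lebesgue_measureRV n]_x f (m *: (x : 'rV[R]_n))%R)%E.
Proof.
move=> m0; elim: n f => [|n IH] f mf f0.
  rewrite /= !integral_dirac// ?diracE ?mem_set// ?mul1e ?scaler0//.
  exact: (measurableT_comp mf (measurable_scalerv m)).
have mfm : measurable_fun setT (fun x : borelRV R n.+1 => f (m *: (x : 'rV[R]_n.+1))).
  exact: (measurableT_comp mf (measurable_scalerv m)).
rewrite (integral_rv_cons mf f0) (integral_rv_cons mfm)//.
rewrite (lebesgue_integral_scale m0)//; last 2 first.
  exact: (measurable_integral_rv_cons mf f0).
  by move=> s; exact: integral_ge0.
rewrite exprS EFinM -muleA; congr (_ * _)%E.
rewrite -ge0_integralZl//; last 3 first.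
- exact: (measurable_integral_rv_cons mfm).
- by move=> s _; exact: integral_ge0.
- by rewrite lee_fin exprn_ge0// ltW.
apply: eq_integral => s _; rewrite IH//; last first.
  apply: measurableT_comp => //.
  apply: (@measurableT_comp _ _ _ _ _ _ (@rv_cons R n)); first exact: measurable_rv_cons.
  exact: measurable_pair1.
congr (_ * _)%E; apply: eq_integral => v _; congr f.
(* Scaling is the linear combination with second coefficient 0. *)
have := rv_cons_lincomb m 0 s s v v.
by rewrite !mul0r !scale0r !addr0.
Qed.

End lebesgue_measureRV_integral.

(** * Measurability of convex functions *)

Section convex_functions.
Context {R : realType} (n : nat).
Variable V : 'rV[R]_n -> R.
Hypothesis V_convex : convex_function [set: convex_lmodType 'rV[R]_n] V.

Lemma convex_functionE (a b : R) (x y : 'rV[R]_n) :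
  0 <= a -> 0 <= b -> a + b = 1 -> V (a *: x + b *: y) <= a * V x + b * V y.
Proof.
move=> a0 b0 ab; have a1 : a <= 1 by rewrite -ab lerDl.
have -> : b = 1 - a by rewrite -ab addrC addKr.
exact: (V_convex (Itv01 a0 a1) (in_setT x) (in_setT y)).
Qed.

(** Local boundedness from above, one coordinate at a time. The sum is the midpoint of twice its
    first term, which lies between [- e] and [e], and twice the rest. Doubling the rest doubles the
    cube, hence an induction over every [M]. *)
Lemma convex_function_bounded_sum (s : seq 'I_n) (M : R) :
  exists C, forall x : 'rV[R]_n, (forall j, `|x ord0 j| <= M) ->
    V (\sum_(j <- s) x ord0 j *: delta_mx 0 j) <= C.
Proof.
have half : 2^-1 + 2^-1 = 1 :> R by field.
have half0 : 0 <= 2^-1 :> R by rewrite invr_ge0.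
elim: s M => [|j s IH] M; first by exists (V 0) => x _; rewrite big_nil.
have [C VC] := IH (2 * M).
pose e : 'rV[R]_n := (2 * M) *: delta_mx 0 j.
exists (2^-1 * (`|V e| + `|V (- e)|) + 2^-1 * C) => x xM; rewrite big_cons.
have -> : x ord0 j *: delta_mx 0 j + \sum_(i <- s) x ord0 i *: delta_mx 0 i =
    2^-1 *: ((2 * x ord0 j) *: delta_mx 0 j) +
    2^-1 *: (\sum_(i <- s) (2 *: x) ord0 i *: delta_mx 0 i) :> 'rV[R]_n.
  congr +%R; first by rewrite scalerA mulKf// pnatr_eq0.
  rewrite scaler_sumr; apply: eq_bigr => i _.
  by rewrite mxE scalerA mulKf// pnatr_eq0.
apply: le_trans (convex_functionE _ _ half0 half0 half) _.
have M0 : 0 <= M by apply: le_trans (xM j).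
apply: lerD; apply: ler_wpM2l => //; last first.
  by apply: VC => i; rewrite mxE normrM ger0_norm// ler_wpM2l.
(* The barycentric weights below divide by [M], so [M = 0] is treated apart. *)
have [M1|] := ltP 0 M; last first.
  move=> M1; have M00 : M = 0 by apply/eqP; rewrite eq_le M0 M1.
  have -> : x ord0 j = 0 by apply/eqP; rewrite -normr_le0 -M00.
  rewrite /e M00 !mulr0 scale0r oppr0.
  by rewrite (le_trans (ler_norm _))// lerDl.
have -> : (2 * x ord0 j) *: delta_mx 0 j =
    ((1 + x ord0 j / M) / 2) *: e + ((1 - x ord0 j / M) / 2) *: - e.
  rewrite scalerN -scaleNr -scalerDl scalerA; congr (_ *: _).
  by field; rewrite gt_eqF.
have : `|x ord0 j / M| <= 1 by rewrite normrM normfV (gtr0_norm M1) ler_pdivrMr ?mul1r.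
rewrite ler_norml => /andP[h1 h2].
apply: le_trans (convex_functionE _ _ _ _ _) _; [lra|lra|by field; rewrite gt_eqF|].
apply: lerD; apply: le_trans (ler_norm _) _; rewrite normrM ler_piMl// ger0_norm; lra.
Qed.

(** Convexity turns an upper bound near [x] into upper semicontinuity: moving a fraction [eta] of
    the way from [x] to [x + w] raises [V] by at most [eta * D]. *)
Lemma open_convex_sublevel (a : R) : open [set x : 'rV[R]_n | V x < a].
Proof.
rewrite openE => x /= Vxa.
have [C VC] := convex_function_bounded_sum (index_enum 'I_n) 2.
(* The maximum with 1 keeps [D] positive, so [eta] can be chosen with [eta * D] at most half the gap
   [a - V x]. *)
pose D := Num.max 1 (2^-1 * V (2 *: x) + 2^-1 * C - V x).
have D0 : 0 < D by rewrite lt_max ltr01.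
pose eta := Num.min 1 ((a - V x) / 2 / D).
have eta0 : 0 < eta by rewrite lt_min ltr01 !divr_gt0 ?subr_gt0.
have eta1 : eta <= 1 by rewrite ge_min lexx.
apply/nbhs_ballP; exists eta => //= y [_ xy].
pose w := eta^-1 *: (y - x).
have -> : y = (1 - eta) *: x + eta *: (x + w).
  by rewrite scalerDr scalerA divff ?gt_eqF// scale1r addrA -scalerDl subrK scale1r subrKC.
apply: le_lt_trans (convex_functionE _ _ _ (ltW eta0) (subrK _ _)) _.
  by rewrite subr_ge0.
(* [x + w] is the midpoint of [2 *: x] and [2 *: w]; the latter has coordinates of size at most 2
   because [y] is within [eta] of [x]. *)
have Vxw : V (x + w) - V x <= D.
  rewrite le_max lerD2r; apply/orP; right.
  have -> : x + w = 2^-1 *: (2 *: x) + 2^-1 *: (2 *: w).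
    by rewrite !(scalerA 2^-1 2) mulVf ?pnatr_eq0// !scale1r.
  apply: le_trans (convex_functionE _ _ _ _ _) _; [by rewrite invr_ge0..|by field|].
  rewrite lerD2l ler_wpM2l ?invr_ge0//.
  rewrite [2 *: w]row_sum_delta; apply: VC => j.
  rewrite !mxE normrM ger0_norm// ler_piMr// normrM normfV (gtr0_norm eta0).
  rewrite ler_pdivrMl// mulr1 distrC; have := xy ord0 j.
  by rewrite -ball_normE /= => /ltW.
have eD : eta * D <= (a - V x) / 2 by rewrite -ler_pdivlMr// ge_min lexx orbT.
have : eta * (V (x + w) - V x) <= eta * D by rewrite ler_wpM2l// ltW.
by move: Vxa; lra.
Qed.

Lemma measurable_convex_function :
  measurable_fun [set: borelRV R n] (V : borelRV R n -> R).
Proof.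
apply: (measurability _ (RGenInftyO.measurableE R)) => _ [_ [a ->] <-].
rewrite setTI; apply: sub_sigma_algebra => /=.
rewrite (_ : _ @^-1` _ = [set x : 'rV[R]_n | V x < a]).
  exact: open_convex_sublevel.
by apply/seteqP; split => x /=; rewrite in_itv.
Qed.

End convex_functions.

(** * The one-variable inequality behind the choice of dilations *)

Section scaling_inequality.
Context {R : realType}.
Variables (th q : R).
Hypotheses (th01 : 0 < th < 1) (q1 : 1 < q).

Let th0 : 0 < th. Proof. by case/andP: th01. Qed.
Let th1 : th < 1. Proof. by case/andP: th01. Qed.
Let q0 : 0 < q. Proof. exact: lt_trans q1. Qed.

Let g (k x : R) : R := ln (1 - th * expR (- k * x)).

Let arg_gt0 (k x : R) : 0 <= k -> 0 <= x -> 0 < 1 - th * expR (- k * x).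
Proof.
move=> k0 x0; rewrite subr_gt0; apply: le_lt_trans th1.
by rewrite ler_piMr ?(ltW th0)// expR_le1 mulNr oppr_le0 mulr_ge0.
Qed.

Let is_derive_g (k x : R) : 0 <= k -> 0 <= x ->
  is_derive x 1 (g k) (th * k * expR (- k * x) / (1 - th * expR (- k * x))).
Proof.
move=> k0 x0.
have d1 : is_derive x 1 ((- k) \*: (@id R)) ((- k) *: 1) by exact: is_deriveZ.
have d2 := is_derive1_comp (is_derive_expR _) d1.
have d3 := is_deriveB (is_derive_cst (1 : R) x 1) (is_deriveZ th d2).
have pos : 0 < (cst 1 - (th \*: (expR \o (- k \*: (@id R))))) x by exact: arg_gt0.
have d4 := is_derive1_comp (is_derive1_ln pos) d3.
have <- : (1 - th * expR (- k * x))^-1 * (0 - th * (expR (- k * x) * (- k * 1))) =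
    th * k * expR (- k * x) / (1 - th * expR (- k * x)).
  by rewrite mulrC; congr (_ * _); rewrite mulr1 sub0r !mulrN opprK mulrA mulrAC.
exact: d4.
Qed.

Lemma bernoulli_powR (y : R) : 0 <= y -> 1 - y `^ q <= q * (1 - y).
Proof.
move=> y0; have := @powR_weighted_amgm _ (1 - q^-1) (y `^ q) 1.
rewrite powR1 mulr1 subKr -powRrM divff ?gt_eqF// powRr1// powR_ge0 ler01.
rewrite subr_gt0 invf_lt1// q1 gtrDl oppr_lt0 invr_gt0 q0.
move=> /(_ isT isT isT); rewrite mulr1 -(ler_pM2l q0) mulrDr mulVKf ?gt_eqF//.
by rewrite mulrBr divff ?gt_eqF//; lra.
Qed.

(** The variable [x] stands for [- ln y]; [F x - F 0] is then the quantity in [ln_scaling_ge0]. *)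
Let F (x : R) : R :=
  (q ^+ 2 - q) * th * x - q ^+ 2 * (1 - th) * g 1 x + (1 - th) * g q x.

Let dF_ge0 (x : R) : 0 <= x -> exists2 d, 0 <= d & is_derive x 1 F d.
Proof.
move=> x0; have dg1 := is_derive_g ler01 x0; have dgq := is_derive_g (ltW q0) x0.
have a1 := arg_gt0 ler01 x0; have aq := arg_gt0 (ltW q0) x0.
have did : is_derive x 1 (((q ^+ 2 - q) * th) \*: (@id R)) (((q ^+ 2 - q) * th) *: 1).
  exact: is_deriveZ.
have := is_deriveD (is_deriveB did (is_deriveZ (q ^+ 2 * (1 - th)) dg1))
  (is_deriveZ (1 - th) dgq).
set d := (X in is_derive _ _ _ X) => dF; exists d => //.
have eqE : expR (- q * x) = expR (- 1 * x) `^ q by rewrite -expRM; congr expR; ring.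
rewrite /d /GRing.scale /=; rewrite eqE in aq *.
set y := expR (- 1 * x) in a1 aq *.
have y0 : 0 <= y by rewrite expR_ge0.
have y1 : y <= 1 by rewrite expR_le1 mulN1r oppr_le0.
have yq : y `^ q <= y by rewrite ge1r_powR ?expR_gt0 ?y1 ?ltW.
have By := bernoulli_powR y0.
set z := y `^ q in aq yq By *.
have -> : (q ^+ 2 - q) * th * 1 - q ^+ 2 * (1 - th) * (th * 1 * y / (1 - th * y)) +
    (1 - th) * (th * q * z / (1 - th * z)) =
    th * q * (q * (1 - y) / (1 - th * y) - (1 - z) / (1 - th * z)).
  by field; rewrite !gt_eqF.
rewrite mulr_ge0 ?subr_ge0//; first by rewrite mulr_ge0 ?ltW.
(* Bernoulli compares the numerators, and [z <= y] compares the denominators. *)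
apply: (@le_trans _ _ (q * (1 - y) / (1 - th * z))).
  by rewrite ler_pM2r ?invr_gt0.
apply: ler_wpM2l; first by rewrite mulr_ge0 ?subr_ge0// ltW.
by rewrite lef_pV2 ?posrE// lerD2l lerN2 ler_pM2l.
Qed.

Let F_ge (x : R) : 0 <= x -> F 0 <= F x.
Proof.
move=> x0.
have derF y : 0 <= y -> derivable F y 1 by move=> /dF_ge0[d _ []].
have incF : {in `[0, x]%R &, {homo F : y z / y <= z}}.
  apply: ger0_derive1_le_cc.
  - by move=> y; rewrite in_itv /= => /andP[/ltW y0 _]; exact: derF.
  - move=> y; rewrite in_itv /= => /andP[/ltW /dF_ge0[d d0 dF] _].
    by rewrite derive1E derive_val.
  - apply: derivable_within_continuous => y; rewrite in_itv /= => /andP[y0 _].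
    exact: derF.
by apply: (incF 0 x _ _ x0); rewrite in_itv /= lexx ?x0.
Qed.

Lemma ln_scaling_ge0 (y : R) : 0 < y <= 1 ->
  0 <= (1 - th) * (ln (1 - th * y `^ q) - ln (1 - th) +
         q ^+ 2 * (ln (1 - th) - ln (1 - th * y))) - th * (q ^+ 2 - q) * ln y.
Proof.
move=> /andP[y0 y1].
have /F_ge : 0 <= - ln y by rewrite oppr_ge0 ln_le0.
rewrite /F /g !mulr0 expR0 !mulr1 !mulrNN mul1r lnK ?posrE//.
have -> : expR (q * ln y) = y `^ q by rewrite mulrC expRM lnK.
by lra.
Qed.

End scaling_inequality.

Lemma ln_geomean (R : realType) (a b u v : R) : 0 < u -> 0 < v ->
  ln (u `^ a * v `^ b) = a * ln u + b * ln v.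
Proof. by move=> u0 v0; rewrite lnM ?posrE ?powR_gt0// !ln_powR. Qed.

(** * Existence of the weight and the dilations *)

Section optimal_scaling.
Context {R : realType}.

(* The weight and dilations at which the Prekopa-Leindler bound
   [(m0 ^ n N0) ^ (1 - th) (m1 ^ n N1) ^ th] implies the claim, written for
   [X_i] equal to [N_i ^ (1 / (n q))]. *)
Definition scaling_data (q t X0 X1 th m0 m1 : R) : Prop :=
  [/\ 0 < th < 1, 0 < m0, 0 < m1, (1 - th) * m0 <= 1 - t & th * m1 <= t] /\
  (1 - th) * m0 `^ q + th * m1 `^ q = 1 /\
  ((1 - t) * X0 + t * X1) `^ q <=
    (m0 * X0 `^ q) `^ (1 - th) * (m1 * X1 `^ q) `^ th.

Lemma exists_scaling_data_le (q t X0 X1 : R) : 1 < q -> 0 < t < 1 -> 0 < X0 -> X0 <= X1 ->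
  exists th m0 m1, scaling_data q t X0 X1 th m0 m1.
Proof.
move=> q1 /andP[t0 t1] X00 X01; have X10 : 0 < X1 by exact: lt_le_trans X01.
have q0 : 0 < q by exact: lt_trans q1.
have t1' : 0 < 1 - t by rewrite subr_gt0.
rewrite /scaling_data; set Y := (1 - t) * X0 + t * X1.
have Y0 : 0 < Y by rewrite addr_gt0// mulr_gt0.
have YX1 : Y <= X1 by rewrite -subr_ge0 (_ : _ - _ = (1 - t) * (X1 - X0))
  ?mulr_ge0 ?subr_ge0 ?(ltW t1)//; rewrite /Y; ring.
pose y := Y / X1; pose th := t * X1 / Y.
have y0 : 0 < y by rewrite divr_gt0.
have y1 : y <= 1 by rewrite ler_pdivrMr// mul1r.
have thy : th * y = t by rewrite /th /y; field; rewrite !gt_eqF.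
have th' : 1 - th = (1 - t) * X0 / Y.
  rewrite /th; have Yn0 : Y != 0 by rewrite gt_eqF.
  by rewrite -[LHS](mulfK Yn0) mulrBl divfK// /Y; congr (_ / _); ring.
have th0 : 0 < th by rewrite divr_gt0// mulr_gt0.
have th1' : 0 < 1 - th by rewrite th' divr_gt0// mulr_gt0.
have th1 : th < 1 by rewrite -subr_gt0.
have yq1 : y `^ q <= 1 by rewrite (le_trans _ y1)// ge1r_powR ?y0 ?y1 ?(ltW q1).
have A0 : 0 < 1 - th * y `^ q.
  by rewrite subr_gt0; apply: le_lt_trans th1; rewrite ler_piMr// ltW.
(* With [m1 = y], this is the solution of the constraint [sum1]. *)
pose m0 := ((1 - th * y `^ q) / (1 - th)) `^ q^-1.
have m00 : 0 < m0 by apply: powR_gt0; rewrite divr_gt0.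
have sum1 : (1 - th) * m0 `^ q + th * y `^ q = 1.
  rewrite -powRrM mulVf ?gt_eqF// powRr1 ?divr_ge0 ?(ltW A0) ?(ltW th1')//.
  by rewrite mulrC divfK ?gt_eqF// subrK.
exists th, m0, y; split; last split => //.
  rewrite th0 th1 thy; split => //.
  (* Bernoulli at [m0] and at [y], averaged with weights [1 - th] and [th]: the left sides add up to
     0 by [sum1]. *)
  have B0 := ler_wpM2l (ltW th1') (bernoulli_powR q1 (ltW m00)).
  have By := ler_wpM2l (ltW th0) (bernoulli_powR q1 (ltW y0)).
  suff : 0 <= q * (1 - t - (1 - th) * m0) by rewrite pmulr_rge0// subr_ge0.
  rewrite -thy (_ : q * _ = (1 - th) * (q * (1 - m0)) + th * (q * (1 - y))); last ring.
  by apply: le_trans (lerD B0 By); rewrite -subr_ge0 subr0; lra.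
have := @ln_scaling_ge0 _ th q _ q1 y; rewrite th0 th1 y0 y1 => /(_ isT isT) H.
have lnP (m X : R) : 0 < m -> 0 < X -> 0 < m * X `^ q /\
    ln (m * X `^ q) = ln m + q * ln X.
  by move=> mgt0 Xgt0; rewrite mulr_gt0 ?powR_gt0// lnM ?posrE ?powR_gt0// ln_powR.
have [P0 lP] := lnP _ _ m00 X00; have [P1 lP1] := lnP _ _ y0 X10.
have W0 := powR_gt0 (1 - th) P0; have W1 := powR_gt0 th P1.
have YP : Y `^ q \is Num.pos by rewrite posrE powR_gt0.
have WP := mulr_gt0 W0 W1; rewrite -posrE in WP; rewrite -(ler_ln YP WP).
rewrite ln_powR ln_geomean// lP lP1.
have -> : ln m0 = q^-1 * (ln (1 - th * y `^ q) - ln (1 - th)).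
  by rewrite /m0 ln_powR ln_div ?posrE.
(* Expressing [X0] and [X1] through [Y], [th] and [y] cancels [ln Y]; after multiplication by [q]
   the remaining inequality is [H]. *)
have lX1 : ln X1 = ln Y - ln y.
  by rewrite /y ln_div ?posrE//; ring.
have lX0 : ln X0 = ln Y + ln (1 - th) - ln (1 - th * y).
  rewrite thy -lnM ?posrE// -ln_div ?posrE ?mulr_gt0//; congr ln.
  by rewrite th'; field; rewrite !gt_eqF.
rewrite -(ler_pM2l q0) -subr_ge0; apply: le_trans H _.
rewrite le_eqVlt; apply/orP; left; apply/eqP.
rewrite lX0 lX1; field; rewrite gt_eqF//.
Qed.

(** The other order follows by exchanging the two bodies, with [t] and [th] replaced by their
    complements to 1. *)
Lemma exists_scaling_data (q t X0 X1 : R) : 1 < q -> 0 < t < 1 -> 0 < X0 -> 0 < X1 ->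
  exists th m0 m1, scaling_data q t X0 X1 th m0 m1.
Proof.
move=> q1 t01 X00 X10; have [X01|/ltW X10'] := leP X0 X1.
  exact: exists_scaling_data_le.
have t01' : 0 < 1 - t < 1.
  by case/andP: t01 => t0 t1; rewrite subr_gt0 t1 gtrDl oppr_lt0.
have [th [m0 [m1 [[/andP[th0 th1] m00 m10 m0t m1t] [sum1 H]]]]] :=
  exists_scaling_data_le q1 t01' X10 X10'.
have tE : 1 - (1 - t) = t by ring.
rewrite tE in m0t H.
exists (1 - th), m1, m0; rewrite /scaling_data subKr; split; last split.
- by split => //; rewrite subr_gt0 th1 gtrDl oppr_lt0.
- by rewrite addrC.
- by rewrite [leRHS]mulrC (addrC ((1 - t) * _)).
Qed.

End optimal_scaling.

(** * Bounds for outer measures and for finite geometric means *)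

Lemma le_completed_measure_extension d (T : measurableType d) (R : realType)
    (mu : {measure set T -> \bar R}) (a : \bar R) (X : set T) :
  (forall B, measurable B -> X `<=` B -> (a <= mu B)%E) ->
  (a <= @completed_measure_extension _ _ R mu X)%E.
Proof.
move=> aB; apply: le_ereal_inf_tmp => _ [A [mA XA] <-].
(* The union of a countable measurable cover is one measurable superset, and subadditivity bounds
   its measure by the sum. *)
have mU : measurable (\bigcup_k A k) by exact: bigcupT_measurable.
by apply: le_trans (aB _ mU XA) _; exact: measure_sigma_subadditive.
Qed.

(** The geometric mean is homogeneous of degree 1, so the strict tests [lam * a] and [lam * b] give
    [lam * G], and [lam] tends to 1. *)
Lemma gm_le_fin (R : realType) (th a b : R) (c : \bar R) :
  0 < a -> 0 < b -> gm_le th a%:E b%:E c ->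
  ((a `^ (1 - th) * b `^ th)%:E <= c)%E.
Proof.
move=> a0 b0 abc; set G := a `^ (1 - th) * b `^ th.
have G0 : 0 < G by rewrite mulr_gt0// powR_gt0.
have lamG (lam : R) : 0 < lam < 1 -> ((lam * G)%:E <= c)%E.
  move=> /andP[l0 l1].
  have := abc (lam * a) (lam * b) (mulr_gt0 l0 a0) (mulr_gt0 l0 b0).
  rewrite !lte_fin !gtr_pMl// => /(_ l1 l1); congr (_%:E <= _)%E.
  rewrite !powRM ?(ltW l0) ?(ltW a0) ?(ltW b0)// mulrACA -powRD ?subrK ?oner_eq0//.
  by rewrite powRr1 ?ltW.
have half01 : 0 < (2^-1 : R) < 1 by lra.
case: c abc lamG => [c| |] _ lamG; rewrite ?leey//; last by have := lamG 2^-1 half01.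
rewrite lee_fin leNgt; apply/negP => cG.
have c0 : 0 < c.
  by have := lamG 2^-1 half01; rewrite lee_fin; apply: lt_le_trans; rewrite mulr_gt0 ?invr_gt0.
(* This [lam] makes [lam * G] the midpoint of [c] and [G], which exceeds [c]. *)
have lam01 : 0 < (c / G + 1) / 2 < 1.
  have : c / G < 1 by rewrite ltr_pdivrMr// mul1r.
  have : 0 < c / G by rewrite divr_gt0.
  by lra.
have := lamG _ lam01; rewrite lee_fin; apply/negP; rewrite -ltNge.
have -> : (c / G + 1) / 2 * G = (c + G) / 2 by field; rewrite gt_eqF.
by rewrite (midf_lt cG).
Qed.

(** * The inequality for measurable sets containing the Minkowski average *)

Section homogeneous_density.
Context {R : realType} (n : nat).
Variables (p : R) (V : 'rV[R]_n -> R) (c : R).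
Variable nu : {measure set (borelRV R n) -> \bar R}.
Hypotheses (p1 : 1 < p) (V_ge0 : forall x, 0 <= V x) (V_hom : homogeneous p V).
Hypothesis V_convex : convex_function [set: convex_lmodType 'rV[R]_n] V.
Hypothesis c0 : 0 < c.
Hypothesis nu_density : forall A : set (borelRV R n), measurable A ->
  nu A = (\int[lebesgue_measureRV n]_(x in A) (c * expR (- V x))%:E)%E.

Let s : R := p / (p - 1).

Let p0 : 0 < p. Proof. exact: lt_trans p1. Qed.
Let p1' : 0 < p - 1. Proof. by rewrite subr_gt0. Qed.

(* This is Hoelder's inequality for [V `^ p^-1], read off from convexity: the
   weights [(1 - th) * m0 `^ s] and [th * m1 `^ s] multiply the points
   [m0 `^ (1 - s) *: x] and [m1 `^ (1 - s) *: y]. *)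
Lemma homogeneous_convex_le (th m0 m1 : R) (x y : 'rV[R]_n) :
  0 < th < 1 -> 0 < m0 -> 0 < m1 ->
  (1 - th) * m0 `^ s + th * m1 `^ s = 1 ->
  V (((1 - th) * m0) *: x + (th * m1) *: y) <= (1 - th) * V x + th * V y.
Proof.
move=> /andP[th0 th1] m00 m10 sum1.
have th1' : 0 < 1 - th by rewrite subr_gt0.
have scal (m : R) (z : 'rV[R]_n) : 0 < m ->
    m `^ s * m `^ (1 - s) = m /\ m `^ s * V (m `^ (1 - s) *: z) = V z.
  move=> mgt0; rewrite -powRD; last by rewrite (gt_eqF mgt0) implybT.
  rewrite subrKC powRr1 ?ltW//; split => //.
  rewrite V_hom ?powR_gt0// mulrA -powRrM -powRD; last by rewrite (gt_eqF mgt0) implybT.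
  rewrite (_ : s + _ = 0) ?powRr0 ?mul1r// /s.
  by field; rewrite gt_eqF.
have [ex Vx] := scal _ x m00; have [ey Vy] := scal _ y m10.
rewrite -{1}ex -{1}ey !mulrA -!scalerA.
rewrite !(scalerA (1 - th)) !(scalerA th).
apply: le_trans (convex_functionE V_convex _ _ _ _ sum1) _.
- by rewrite mulr_ge0 ?powR_ge0// ltW.
- by rewrite mulr_ge0 ?powR_ge0// ltW.
- by rewrite -!mulrA Vx Vy.
Qed.

Let dens (A : set 'rV[R]_n) (x : borelRV R n) : \bar R :=
  (\1_A x * (c * expR (- V x)))%:E.

Let dens_ge0 A x : (0 <= dens A x)%E.
Proof. by rewrite lee_fin mulr_ge0// mulr_ge0 ?expR_ge0// ltW. Qed.

Let measurable_dens (A : set (borelRV R n)) :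
  measurable A -> measurable_fun setT (dens A).
Proof.
move=> mA; apply/measurable_EFinP; apply: measurable_funM.
  exact: measurable_indic.
apply: measurable_funM => //; apply: measurableT_comp => //.
apply: measurableT_comp => //; exact: measurable_convex_function.
Qed.

Let nuE (A : set (borelRV R n)) : measurable A ->
  nu A = (\int[lebesgue_measureRV n]_x dens A x)%E.
Proof.
move=> mA; rewrite nu_density// integral_mkcond; apply: eq_integral => x _.
by rewrite /dens patchE indicE; case: ifP => _; rewrite ?mul1r ?mul0r.
Qed.

Let dens_gt (A : set 'rV[R]_n) (u : R) (x : 'rV[R]_n) : 0 < u ->
  (u%:E < dens A x)%E -> A x /\ u < c * expR (- V x).
Proof.
move=> u0; rewrite /dens lte_fin indicE; case: (boolP (x \in A)).
  by rewrite inE mul1r.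
by rewrite mul0r => _ /(lt_trans u0); rewrite ltxx.
Qed.

Let densE (A : set 'rV[R]_n) (x : 'rV[R]_n) : A x -> dens A x = (c * expR (- V x))%:E.
Proof. by move=> Ax; rewrite /dens indicE mem_set// mul1r. Qed.

(** Change of scale produces [w ^+ n], and homogeneity makes [V] no larger at [w *: x] than at [x]
    since [w <= 1]. *)
Lemma measure_dilate_le (w : R) (K B : set (borelRV R n)) :
  0 < w <= 1 -> measurable K -> measurable B ->
  (forall x : 'rV[R]_n, K x -> B (w *: x)) ->
  ((w ^+ n)%:E * nu K <= nu B)%E.
Proof.
move=> /andP[w0 w1] mK mB KB; rewrite !nuE//.
rewrite (lebesgue_measureRV_scale w0 (measurable_dens mB)); last by move=> x; exact: dens_ge0.
apply: lee_wpmul2l; first by rewrite lee_fin exprn_ge0// ltW.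
apply: ge0_le_integral => //.
- exact: measurable_dens.
- exact: (measurableT_comp (measurable_dens mB) (measurable_scalerv w)).
move=> x _; have [xK|xK] := pselect (K x).
  rewrite !densE//; last exact: KB.
  rewrite lee_fin ler_pM2l// ler_expR lerN2 V_hom// ler_piMl//.
  by rewrite (le_trans _ w1)// ge1r_powR ?w0 ?w1// ltW.
by rewrite /dens indicE memNset// mul0r; exact: dens_ge0.
Qed.

(** Prekopa-Leindler is fed with [dens K0] and [dens K1] composed with division by [m0] and [m1];
    the integrals of these carry the factors [m0 ^+ n] and [m1 ^+ n]. *)
Lemma measure_minkowski_gm (th m0 m1 t : R) (K0 K1 B : set (borelRV R n)) :
  0 < t < 1 -> 0 < th < 1 -> 0 < m0 -> 0 < m1 ->
  (1 - th) * m0 <= 1 - t -> th * m1 <= t ->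
  (1 - th) * m0 `^ s + th * m1 `^ s = 1 ->
  star_body K0 -> star_body K1 -> measurable B ->
  minkowski_average t K0 K1 `<=` B ->
  gm_le th ((m0 ^+ n)%:E * nu K0)%E ((m1 ^+ n)%:E * nu K1)%E (nu B).
Proof.
move=> /andP[t0 t1] th01 m00 m10 m0t m1t sum1 [mK0 sK0] [mK1 sK1] mB KB.
have /andP[th0 th1] := th01.
have t1' : 0 < 1 - t by rewrite subr_gt0.
have th1' : 0 < 1 - th by rewrite subr_gt0.
have mscal (m : R) (K : set (borelRV R n)) : measurable K ->
    measurable_fun setT (fun x : borelRV R n => dens K (m^-1 *: (x : 'rV[R]_n))).
  by move=> mK; exact: (measurableT_comp (measurable_dens mK) (measurable_scalerv m^-1)).
have nu_scal (m : R) (K : set (borelRV R n)) : 0 < m -> measurable K ->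
    ((m ^+ n)%:E * nu K =
     \int[lebesgue_measureRV n]_x dens K (m^-1 *: (x : 'rV[R]_n)))%E.
  move=> m_gt0 mK; rewrite (lebesgue_measureRV_scale m_gt0 (mscal m K mK))//.
  rewrite (nuE mK); congr (_ * _)%E; apply: eq_integral => x _.
  by rewrite scalerA mulVf ?gt_eqF// scale1r.
rewrite (nu_scal _ _ m00 mK0) (nu_scal _ _ m10 mK1) (nuE mB).
apply: (prekopa_leindler th01 (mscal m0 _ mK0) (mscal m1 _ mK1) (measurable_dens mB)).
- by move=> x; exact: dens_ge0.
- by move=> x; exact: dens_ge0.
- by move=> x; exact: dens_ge0.
move=> X Y u v u0 v0 /(dens_gt u0) [K0x ux] /(dens_gt v0)[K1y vy].
move: K0x ux K1y vy; set x : 'rV[R]_n := m0^-1 *: X; set y : 'rV[R]_n := m1^-1 *: Y.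
move=> K0x ux K1y vy.
have ZE : (1 - th) *: X + th *: Y = ((1 - th) * m0) *: x + (th * m1) *: y.
  by rewrite /x /y !scalerA !mulfK ?gt_eqF.
(* The factors [(1 - th) * m0 / (1 - t)] and [th * m1 / t] are at most 1, so the shrunken points
   stay in the star bodies. *)
have BZ : B (((1 - th) * m0) *: x + (th * m1) *: y).
  apply: KB; exists (((1 - th) * m0 / (1 - t)) *: x).
    apply: sK0 => //; rewrite divr_ge0 ?mulr_ge0 ?(ltW th1') ?(ltW m00) ?(ltW t1')//=.
    by rewrite ler_pdivrMr// mul1r.
  exists ((th * m1 / t) *: y).
    apply: sK1 => //; rewrite divr_ge0 ?mulr_ge0 ?(ltW th0) ?(ltW m10) ?(ltW t0)//=.
    by rewrite ler_pdivrMr// mul1r.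
  by rewrite !scalerA !(mulrC _ (_ / _)) !divfK ?gt_eqF.
rewrite ZE densE// lee_fin.
apply: (@le_trans _ _ ((c * expR (- V x)) `^ (1 - th) * (c * expR (- V y)) `^ th)).
  apply: ler_pM; rewrite ?powR_ge0//; apply: ge0_ler_powR; rewrite ?nnegrE ?(ltW u0) ?(ltW v0)//;
    by rewrite ?ltW// ?mulr_gt0 ?expR_gt0.
have c0' := ltW c0.
rewrite !powRM ?expR_ge0// mulrACA -powRD ?subrK ?oner_eq0// powRr1//.
rewrite -!expRM -expRD ler_pM2l// ler_expR.
have := homogeneous_convex_le x y th01 m00 m10 sum1; lra.
Qed.

Hypothesis n_gt0 : (0 < n)%N.

Let q : R := (p - 1) / (p * n%:R).

Let nR : 0 < n%:R :> R. Proof. by rewrite ltr0n. Qed.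
Let q0 : 0 < q. Proof. by rewrite divr_gt0// mulr_gt0. Qed.
Let s1 : 1 < s. Proof. by rewrite ltr_pdivlMr// mul1r gtrDl oppr_lt0. Qed.
Let sqn : s * n%:R * q = 1.
Proof. by rewrite /s /q; field; rewrite !gt_eqF. Qed.

Let poweR_q_le (a b : \bar R) : (0 <= a)%E -> (a <= b)%E -> (a `^ q <= b `^ q)%E.
Proof.
move=> a0 ab; apply: gt0_ler_poweR => //; first exact: ltW.
- by rewrite in_itv /= a0 leey.
- by rewrite in_itv /= (le_trans a0 ab) leey.
Qed.

Lemma measure_dilate_poweR_le (w : R) (K B : set (borelRV R n)) :
  0 < w <= 1 -> measurable K -> measurable B ->
  (forall x : 'rV[R]_n, K x -> B (w *: x)) ->
  (w%:E * nu K `^ q <= nu B `^ q)%E.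
Proof.
move=> w01 mK mB KB; have /andP[w0 w1] := w01.
have wn0 : (0 <= (w ^+ n)%:E)%E by rewrite lee_fin exprn_ge0// ltW.
have := measure_dilate_le w01 mK mB KB => /(poweR_q_le (mule_ge0 wn0 (measure_ge0 nu K))).
apply: le_trans; rewrite poweRM//; apply: lee_wpmul2r; first exact: poweR_ge0.
rewrite poweR_EFin lee_fin -powR_mulrn ?(ltW w0)// -powRrM.
(* Here [n%:R * q] is the inverse of [s > 1], so [w] is at most its power with this exponent. *)
have nq : n%:R * q <= 1.
  by rewrite -[leRHS]sqn -(mulrA s) ler_peMl ?(ltW s1)// mulr_ge0 ?(ltW nR) ?(ltW q0).
by rewrite ger1_powR// w0.
Qed.

Lemma measure_minkowski_le (t : R) (K0 K1 B : set (borelRV R n)) :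
  0 < t < 1 -> star_body K0 -> star_body K1 -> K0 !=set0 -> K1 !=set0 ->
  measurable B -> minkowski_average t K0 K1 `<=` B ->
  ((1 - t)%:E * nu K0 `^ q + t%:E * nu K1 `^ q <= nu B `^ q)%E.
Proof.
move=> t01 sb0 sb1 [k0 k0K] [k1 k1K] mB KB; have /andP[t0 t1] := t01.
have t1' : 0 < 1 - t by rewrite subr_gt0.
have [mK0 sK0] := sb0; have [mK1 sK1] := sb1.
have K00 : K0 (0 : 'rV[R]_n).
  by rewrite -(scale0r (k0 : 'rV[R]_n)); apply: sK0; rewrite ?lexx ?ler01.
have K10 : K1 (0 : 'rV[R]_n).
  by rewrite -(scale0r (k1 : 'rV[R]_n)); apply: sK1; rewrite ?lexx ?ler01.
(* Both bodies contain 0, so the average contains the dilates of each. These bounds settle the cases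
   of zero or infinite measure. *)
have D0 : ((1 - t)%:E * nu K0 `^ q <= nu B `^ q)%E.
  apply: measure_dilate_poweR_le => //.
    by rewrite t1' gerDl oppr_le0 ltW.
  by move=> x Kx; apply: KB; exists x => //; exists 0 => //; rewrite scaler0 addr0.
have D1 : (t%:E * nu K1 `^ q <= nu B `^ q)%E.
  apply: measure_dilate_poweR_le => //; first by rewrite t0 ltW.
  by move=> x Kx; apply: KB; exists 0 => //; exists x => //; rewrite scaler0 add0r.
have q_neq0 : q != 0 by rewrite gt_eqF.
have [N00|N00] := eqVneq (nu K0) 0%E.
  by rewrite N00 poweR0r// mule0 add0e.
have [N10|N10] := eqVneq (nu K1) 0%E.
  by rewrite N10 poweR0r// mule0 adde0.
have [N0y|N0y] := eqVneq (nu K0) +oo%E.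
  move: D0; rewrite N0y poweRyr// gt0_muley ?lte_fin// leye_eq => /eqP ->.
  exact: leey.
have [N1y|N1y] := eqVneq (nu K1) +oo%E.
  move: D1; rewrite N1y poweRyr// gt0_muley ?lte_fin// leye_eq => /eqP ->.
  exact: leey.
have fin_gt0 (K : set (borelRV R n)) : nu K != 0%E -> nu K != +oo%E ->
    exists2 N : R, 0 < N & nu K = N%:E.
  have NK_ge0 : (0 <= nu K)%E by exact: measure_ge0.
  case: (nu K) NK_ge0 => [N| |]// N_ge0 N_neq0 _.
  by exists N => //; rewrite -lte_fin lt_neqAle eq_sym N_neq0.
have [N0 N0_gt0 N0E] := fin_gt0 _ N00 N0y.
have [N1 N1_gt0 N1E] := fin_gt0 _ N10 N1y.
have X0 := powR_gt0 q N0_gt0; have X1 := powR_gt0 q N1_gt0.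
have [th [m0 [m1 [[th01 m00 m10 m0t m1t] [sum1 H]]]]] := exists_scaling_data s1 t01 X0 X1.
have := measure_minkowski_gm t01 th01 m00 m10 m0t m1t sum1 sb0 sb1 mB KB.
rewrite N0E N1E -!EFinM => /gm_le_fin.
have P0 : 0 < m0 ^+ n * N0 by rewrite mulr_gt0// exprn_gt0.
have P1 : 0 < m1 ^+ n * N1 by rewrite mulr_gt0// exprn_gt0.
move=> /(_ P0 P1) G.
rewrite -EFinD.
set Y := _ + _ in H *.
have Y0 : 0 < Y by rewrite addr_gt0// mulr_gt0.
(* Since [s * n%:R * q = 1], both sides become [n]-th powers, and what remains is the bound [H]
   between their bases. *)
have -> : Y = (Y `^ s) `^ n%:R `^ q by rewrite -!powRrM mulrA sqn powRr1// ltW.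
rewrite -poweR_EFin; apply: poweR_q_le; first by rewrite lee_fin powR_ge0.
apply: le_trans G; rewrite lee_fin.
have NE (m N : R) : 0 < m -> 0 < N -> m ^+ n * N = (m * (N `^ q) `^ s) `^ n%:R.
  move=> m_gt0 N_gt0; rewrite powRM ?powR_ge0 ?(ltW m_gt0)// powR_mulrn ?(ltW m_gt0)//.
  by rewrite -!powRrM (_ : q * (s * n%:R) = 1) ?powRr1 ?(ltW N_gt0)// -[RHS]sqn mulrC.
rewrite (NE _ _ m00 N0_gt0) (NE _ _ m10 N1_gt0).
have powE (u v a b r : R) : (u `^ r) `^ a * (v `^ r) `^ b = (u `^ a * v `^ b) `^ r.
  by rewrite (powRM _ (powR_ge0 _ _) (powR_ge0 _ _)) -!powRrM !(mulrC r).
rewrite powE; apply: ge0_ler_powR; rewrite ?nnegrE ?powR_ge0 ?(ltW nR)//.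
by apply: mulr_ge0; exact: powR_ge0.
Qed.

End homogeneous_density.

(** * Passage to the Minkowski average itself, with the endpoint weights *)

Theorem theorem1p3 (R : realType) (n : nat) (hn : (0 < n)%N)
  (p : R) (hp : 1 < p)
  (V : 'rV[R]_n -> R) (V_ge0 : forall x, 0 <= V x)
  (V_hom : homogeneous p V)
  (V_convex : convex_function [set: convex_lmodType 'rV[R]_n] V)
  (c : R) (hc : 0 < c)
  (nu : {measure set (borelRV R n) -> \bar R})
  (nu_density : forall A : set (borelRV R n), measurable A ->
     nu A = (\int[lebesgue_measureRV n]_(x in A) (c * expR (- V x))%:E)%E)
  (K0 K1 : set 'rV[R]_n)
  (hK0 : star_body K0) (hK1 : star_body K1)
  (K0_neq0 : K0 !=set0) (K1_neq0 : K1 !=set0)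
  (t : R) (ht : 0 <= t <= 1) :
  let q := (p - 1) / (p * n%:R) in
  ((1 - t)%:E * nu K0 `^ q + t%:E * nu K1 `^ q <=
   @completed_measure_extension _ _ R nu (minkowski_average t K0 K1) `^ q)%E.
Proof.
set q := (p - 1) / _; cbv zeta; have /andP[t0 t1] := ht.
have n0 : 0 < n%:R :> R by rewrite ltr0n.
have q0 : 0 < q by rewrite divr_gt0 ?mulr_gt0 ?subr_gt0// (lt_trans _ hp).
set L := (X in (X <= _)%E).
have L0 : (0 <= L)%E.
  by rewrite adde_ge0// mule_ge0 ?poweR_ge0// lee_fin ?subr_ge0.
have bound (B : set (borelRV R n)) : measurable B ->
    minkowski_average t K0 K1 `<=` B -> (L <= nu B `^ q)%E.
  move=> mB KB; have [[mK0 _] [mK1 _]] := (hK0, hK1).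
  (* At an endpoint the average contains one of the bodies, because the other is nonempty, and
     monotonicity of [nu] suffices. *)
  have [tE|t_neq0] := eqVneq t 0.
    rewrite /L tE subr0 mul1e mul0e adde0.
    have K0B : (K0 : set (borelRV R n)) `<=` B.
      move=> x K0x; apply: KB; exists x => //.
      by have [y K1y] := K1_neq0; exists y; rewrite // tE subr0 scale1r scale0r addr0.
    apply: gt0_ler_poweR; rewrite ?in_itv /= ?measure_ge0 ?leey ?(ltW q0)//.
    by apply: le_measure; rewrite ?inE.
  have [tE|t_neq1] := eqVneq t 1.
    rewrite /L tE subrr mul1e mul0e add0e.
    have K1B : (K1 : set (borelRV R n)) `<=` B.
      move=> y K1y; apply: KB.
      have [x K0x] := K0_neq0; exists x => //.
      by exists y; rewrite // tE subrr scale1r scale0r add0r.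
    apply: gt0_ler_poweR; rewrite ?in_itv /= ?measure_ge0 ?leey ?(ltW q0)//.
    by apply: le_measure; rewrite ?inE.
  apply: (measure_minkowski_le hp V_ge0 V_hom V_convex hc nu_density) => //.
  by rewrite lt_neqAle eq_sym t_neq0 t0 lt_neqAle t_neq1 t1.
have LV : ((L `^ q^-1) `^ q = L)%E by rewrite -poweRrM mulVf ?gt_eqF// poweRe1.
rewrite -[X in (X <= _)%E]LV.
have : (L `^ q^-1 <= @completed_measure_extension _ _ R nu (minkowski_average t K0 K1))%E.
  apply: le_completed_measure_extension => B mB KB.
  have nuB0 : (0 <= nu B)%E by exact: measure_ge0.
  have -> : nu B = ((nu B `^ q) `^ q^-1)%E by rewrite -poweRrM divff ?gt_eqF// poweRe1.
  apply: gt0_ler_poweR; rewrite ?in_itv /= ?poweR_ge0 ?L0 ?leey ?invr_ge0 ?(ltW q0)//.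
  exact: bound.
move=> H; apply: gt0_ler_poweR H; rewrite ?in_itv /= ?poweR_ge0 ?leey ?(ltW q0)//.
by rewrite andbT; exact: mu_ext_ge0.
Qed.
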